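(* Suppose that $G$ is a probability distribution on $\mathbb{R}$ whose CDF is a step function of the form $$G(z)=\sum_{i=1}^N p_i\,\mathbf{1}\{z_i\le z\},\qquad z\in\mathbb{R},$$ where $p_i>0$, $\sum_{i=1}^N p_i=1$ and $z_1<z_2<\cdots<z_N$. Let $(w_i)_{i=1}^{N-1}$ be a tuple of nonnegative numbers, and write $P_i=\sum_{k=1}^i p_k$. Then the scoring function $S_4:\mathbb{R}\times\mathbb{R}\to[0,\infty)$ defined by $$S_4(x,y)=\sum_{i=1}^{N-1}w_i\,S_{P_i,z_i}(x,y),\qquad x,y\in\mathbb{R},$$ is equal to $\mathrm{GDS}_{\mathrm d}(\cdot,\cdot\,;G,\mu)$ when $\mu=\sum_{i=1}^{N-1}w_i\delta_{P_i}$, is equitable with respect to $G$, and has equitability constant $$\sum_{i=1}^{N-1}w_iP_i(1-P_i).$$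
   Context: $\mathbf{1}$ denotes the indicator function and $\delta_a$ the unit point mass at $a$. For $\alpha\in(0,1)$ and $\theta\in\mathbb{R}$, the elementary scoring function is $S_{\alpha,\theta}(x,y)=(\mathbf{1}\{y<x\}-\alpha)(\mathbf{1}\{\theta<x\}-\mathbf{1}\{\theta<y\})$ for $x,y\in\mathbb{R}$, i.e. $\alpha$ if $x\le\theta<y$, $1-\alpha$ if $x>\theta\ge y$, and $0$ otherwise. For a distribution $G$ on $\mathbb{R}$ (identified with its CDF), $G^{-1}(\alpha)=\min\{z\in\mathbb{R}:G(z)\ge\alpha\}$ for $\alpha\in(0,1)$, and $\mathcal{R}(G)=\{\alpha\in(0,1):G(z)=\alpha\text{ for some }z\in\mathbb{R}\}$. For a Borel measure $\mu$ on $(0,1)$ and $x,y\in\mathbb{R}$, $$\mathrm{GDS}_{\mathrm d}(x,y;G,\mu)=\int_{\mathcal{R}(G)}S_{\alpha,G^{-1}(\alpha)}(x,y)\,\mathrm{d}\mu(\alpha).$$ A scoring function $S:\mathcal{F}\times\mathcal{O}\to[-\infty,\infty]$ is equitable with respect to a distribution $G$ on $\mathcal{O}$ if there is $c\in\mathbb{R}$ (the equitability constant) with $\mathbb{E}_G S(x,Y)=c$ for every $x\in\mathcal{F}$, where $Y$ has distribution $G$. *)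

(* Defs.v *)
From HB Require Import structures.
From mathcomp Require Import all_boot all_order all_algebra.
From mathcomp Require Import all_classical all_reals all_analysis.

Set Implicit Arguments.
Unset Strict Implicit.
Unset Printing Implicit Defensive.

Import Order.TTheory GRing.Theory Num.Theory numFieldNormedType.Exports.

Local Open Scope classical_set_scope.
Local Open Scope ring_scope.

Section scores.
Context {R : realType}.

(* S_{alpha,theta}(x,y); it is meant for 0 < alpha < 1. *)
Definition elementary_score (alpha theta x y : R) : R :=
  ((y < x)%R%:R - alpha) * ((theta < x)%R%:R - (theta < y)%R%:R).

Definition idRV : measurableTypeR R -> R := idfun.

HB.instance Definition _ :=
  @isMeasurableFun.Build _ _ _ _ idRV (@measurable_id _ _ setT).

Implicit Types G : probability (measurableTypeR R) R.

(* The CDF of G itself is the CDF of the identity under G. *)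
Definition distr_cdf G (z : R) : R := fine (cdf (idRV : {RV G >-> R}) z).

(* The least element of A; the default value 0 is taken only when A has none. *)
Definition min_of (A : set R) : R := xget 0 (A `&` lbound A).

Definition quantile G (alpha : R) : R :=
  min_of [set z | alpha <= distr_cdf G z].

Definition cdf_levels G : set R :=
  [set alpha | 0 < alpha < 1 /\ exists z, distr_cdf G z = alpha].

(* A Borel measure on (0,1) is represented by a Borel measure on R; only its
   restriction to (0,1) matters since cdf_levels G is a subset of (0,1). *)
Definition GDSd G (mu : {measure set (measurableTypeR R) -> \bar R})
    (x y : R) : \bar R :=
  (\int[mu]_(alpha in cdf_levels G)
    (elementary_score alpha (quantile G alpha) x y)%:E)%E.

End scores.

Section equitability.
Context d {O : measurableType d} {R : realType} {F : Type}.

(* The integrability requirement says that the expectation of S x Y, Y ~ G,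
   is well defined and finite. *)
Definition equitability_constant (S : F -> O -> \bar R) (G : probability O R)
    (c : R) : Prop :=
  forall x : F, G.-integrable setT (S x) /\ (\int[G]_y S x y = c%:E)%E.

Definition equitable (S : F -> O -> \bar R) (G : probability O R) : Prop :=
  exists c : R, equitability_constant S G c.

End equitability.

Section weighted_dirac_sum.
Context {R : realType} {n : nat}.
Variables (w : 'I_n -> {nonneg R}) (a : 'I_n -> measurableTypeR R).

Definition dirac_sum (A : set (measurableTypeR R)) : \bar R :=
  (\sum_(i < n) (w i)%:num%:E * \d_(a i) A)%E.

Let term (k : nat) : {measure set (measurableTypeR R) -> \bar R} :=
  if insub k is Some i then mscale (w i) \d_(a i) else mzero.

Let dirac_sumE : dirac_sum = msum term n.
Proof.
apply/funext => A; rewrite /dirac_sum /msum; apply: eq_bigr => i _.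
by rewrite /term valK.
Qed.

Let dirac_sum0 : dirac_sum set0 = 0%E.
Proof. by rewrite dirac_sumE measure0. Qed.

Let dirac_sum_ge0 A : (0 <= dirac_sum A)%E.
Proof. by rewrite dirac_sumE measure_ge0. Qed.

Let dirac_sum_sigma_additive : semi_sigma_additive dirac_sum.
Proof. by rewrite dirac_sumE; exact: measure_semi_sigma_additive. Qed.

HB.instance Definition _ := isMeasure.Build _ _ _ dirac_sum
  dirac_sum0 dirac_sum_ge0 dirac_sum_sigma_additive.

End weighted_dirac_sum.

Section step_distribution.
Context {R : realType} {N : nat}.

(* Indices are shifted by one: the i-th point is z j with j = i - 1 : 'I_N,
   and an index 1 <= i <= N - 1 is an element of 'I_N.-1. *)
Definition widen_pred (i : 'I_N.-1) : 'I_N := widen_ord (leq_pred N) i.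

Definition partial_mass (p : 'I_N -> R) (i : 'I_N.-1) : R :=
  \sum_(k < N | (k <= i)%N) p k.

Definition S4 (p z : 'I_N -> R) (w : 'I_N.-1 -> {nonneg R}) (x y : R) : R :=
  \sum_(i < N.-1) (w i)%:num *
    elementary_score (partial_mass p i) (z (widen_pred i)) x y.

End step_distribution.

(* Main.v *)
Require Import Defs.
From HB Require Import structures.
From mathcomp Require Import all_boot all_order all_algebra.
From mathcomp Require Import all_classical all_reals all_analysis.
From mathcomp Require Import measurable_realfun.
Import Order.TTheory GRing.Theory Num.Theory numFieldNormedType.Exports.

Local Open Scope classical_set_scope.
Local Open Scope ring_scope.

(** Equitability does not depend on the shape of [G]: whenever [G] has CDF value
    [alpha] at [theta], every forecast [x] has expected elementary score
    [alpha * (1 - alpha)].  Indeed, as a function of [y], the score is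
    [alpha] times the indicator of the half-line right of [theta] when
    [x <= theta], and [1 - alpha] times the indicator of its complement when
    [theta < x] (lemma [expected_elementary_score]).  Since the CDF of a step
    distribution takes the value [P i] at the [i]-th atom [z i], summing with
    weights [w i] gives the equitability constant.

    For the equality with [GDSd], the levels of [G] in the open unit interval
    are exactly the numbers [P i] (lemma [cdf_levels_step]) and the quantile at
    level [P i] is [z i] (lemma [quantile_step]).  The integral against the
    weighted sum of point masses at the [P i] is then the finite sum defining
    [S4]; measurability of the integrand is automatic because the domain of
    integration is finite. *)

(** * Elementary scores *)

Lemma elementary_score_le (R : realType) (alpha theta x y : R) : x <= theta ->
  elementary_score alpha theta x y = alpha * \1_(~` `]-oo, theta]) y.
Proof.
move=> xt; rewrite /elementary_score indicE in_setC.
have -> : (y \in `]-oo, theta]%classic) = (y <= theta).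
  by apply/idP/idP; rewrite inE /= in_itv.
rewrite (le_gtF xt) -ltNge sub0r.
case: (ltP theta y) => [ty|_]; last by rewrite oppr0 !mulr0.
by rewrite (le_gtF (le_trans xt (ltW ty))) sub0r mulrNN.
Qed.

Lemma elementary_score_gt (R : realType) (alpha theta x y : R) : theta < x ->
  elementary_score alpha theta x y = (1 - alpha) * \1_(`]-oo, theta]) y.
Proof.
move=> tx; rewrite /elementary_score indicE.
have -> : (y \in `]-oo, theta]%classic) = (y <= theta).
  by apply/idP/idP; rewrite inE /= in_itv.
rewrite tx; case: (leP y theta) => [yt|_]; last by rewrite subrr !mulr0.
by rewrite (le_lt_trans yt tx) subr0.
Qed.

Lemma elementary_score_ge0 (R : realType) (alpha theta x y : R) :
  0 <= alpha <= 1 -> 0 <= elementary_score alpha theta x y.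
Proof.
move=> /andP[a0 a1]; have [xt|tx] := leP x theta.
  by rewrite elementary_score_le // mulr_ge0 // indicE ler0n.
by rewrite elementary_score_gt // mulr_ge0 ?subr_ge0 // indicE ler0n.
Qed.

Lemma distr_cdfE (R : realType) (G : probability (measurableTypeR R) R) (t : R) :
  G `]-oo, t]%classic = (distr_cdf G t)%:E.
Proof. by rewrite /distr_cdf fineK // fin_num_measure. Qed.

(** If [G] has CDF value [alpha] at [theta], the elementary score at level
    [alpha] and threshold [theta] is equitable, with constant
    [alpha * (1 - alpha)]. *)
Lemma expected_elementary_score (R : realType)
    (G : probability (measurableTypeR R) R) (alpha theta : R) :
  distr_cdf G theta = alpha ->
  equitability_constant
    (fun (x : R) (y : measurableTypeR R) =>
       (elementary_score alpha theta x y)%:E) G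
    (alpha * (1 - alpha)).
Proof.
move=> Ga x.
have mI : measurable (`]-oo, theta]%classic : set (measurableTypeR R)) by [].
have scaled_indic (c : R) (A : set (measurableTypeR R)) : measurable A ->
    G.-integrable setT (fun y => (c * \1_A y)%:E) /\
    (\int[G]_y (c * \1_A y)%:E = c%:E * G A)%E.
  move=> mA; under [X in G.-integrable _ X]eq_fun do rewrite EFinM.
  split; first by apply: integrableZl => //; exact: integrable_indic.
  under eq_integral do rewrite EFinM.
  by rewrite integralZl ?integral_indic ?setIT //; exact: integrable_indic.
have [xt|tx] := leP x theta.
  have [i1 i2] := scaled_indic alpha _ (measurableC mI).
  under [X in _.-integrable _ X]eq_fun do rewrite elementary_score_le //.
  under eq_integral do rewrite elementary_score_le //.
  by split => //; rewrite i2 probability_setC // distr_cdfE Ga.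
have [i1 i2] := scaled_indic (1 - alpha) _ mI.
under [X in _.-integrable _ X]eq_fun do rewrite elementary_score_gt //.
under eq_integral do rewrite elementary_score_gt //.
by split => //; rewrite i2 distr_cdfE Ga -EFinM mulrC.
Qed.

Lemma equitability_constant_sum (d : measure_display) (O : measurableType d)
    (R : realType) (F : Type) (n : nat) (G : probability O R) (w c : 'I_n -> R)
    (S : 'I_n -> F -> O -> R) :
  (forall i, equitability_constant (fun x y => (S i x y)%:E) G (c i)) ->
  equitability_constant (fun x y => (\sum_(i < n) w i * S i x y)%:E) G
    (\sum_(i < n) w i * c i).
Proof.
move=> SG x.
under [X in _.-integrable _ X]eq_fun do rewrite -sumEFin.
under eq_integral do rewrite -sumEFin.
have wS i : G.-integrable setT (fun y => (w i * S i x y)%:E).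
  under eq_fun do rewrite EFinM.
  by apply: integrableZl => //; have [] := SG i x.
split; first exact: integrable_sum.
rewrite integral_sum // -sumEFin; apply: eq_bigr => i _.
have [iS eS] := SG i x.
under eq_integral do rewrite EFinM.
by rewrite integralZl // eS.
Qed.

(** * Integration against a weighted sum of point masses *)

Lemma measurable_fun_finite (d : measure_display) (R : realType)
    (T : measurableType d) (D : set (measurableTypeR R))
    (f : measurableTypeR R -> T) :
  finite_set D -> measurable_fun D f.
Proof.
move=> finD _ Y _; apply: countable_measurable; first exact: measurable_set1.
by apply: finite_set_countable; exact: finite_setIl.
Qed.

Lemma integral_dirac_sum (R : realType) (n : nat) (w : 'I_n -> {nonneg R})
    (a : 'I_n -> measurableTypeR R) (D : set (measurableTypeR R))
    (f : measurableTypeR R -> \bar R) :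
  measurable D -> measurable_fun D f ->
  (forall t, D t -> (0 <= f t)%E) ->
  (\int[dirac_sum w a]_(t in D) f t =
   \sum_(i < n) (w i)%:num%:E * (\d_(a i) D * f (a i)))%E.
Proof.
move=> mD mf f0.
(* [msum] sums a sequence of measures, so the family is extended by the zero
   measure beyond [n]. *)
pose term (k : nat) : {measure set (measurableTypeR R) -> \bar R} :=
  if insub k is Some i then mscale (w i) \d_(a i) else mzero.
rewrite (@eq_measure_integral _ _ _ _ (msum term n)); last first.
  move=> A _ _; rewrite /= /dirac_sum /msum; apply: eq_bigr => i _.
  by rewrite /term valK.
rewrite ge0_integral_measure_sum //; apply: eq_bigr => i _.
by rewrite /term valK ge0_integral_mscale // integral_dirac.
Qed.

(** * Quantiles and levels of a step distribution *)

Lemma min_ofP (R : realType) (A : set R) (m : R) : A m -> lbound A m ->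
  min_of A = m.
Proof.
move=> Am lbm; rewrite /min_of; case: xgetP => [x _ [Ax lbx]|/(_ m)]; last first.
  by case.
by apply/le_anti/andP; split; [exact: lbx|exact: lbm].
Qed.

Section step_cdf.
Context (R : realType) (G : probability (measurableTypeR R) R) (N : nat)
  (p z : 'I_N -> R) (p_gt0 : forall i, 0 < p i) (p_sum1 : \sum_(i < N) p i = 1)
  (z_incr : forall i j : 'I_N, (i < j)%N -> z i < z j)
  (G_step : forall t : R, distr_cdf G t = \sum_(i < N) p i * (z i <= t)%R%:R).

Let P := partial_mass p.

Lemma le_atoms (i j : 'I_N) : (z i <= z j) = (i <= j)%N.
Proof.
have [ij|ji] := leqP i j; last by rewrite leNgt z_incr.
move: ij; rewrite leq_eqVlt => /orP[/eqP/val_inj ->|/z_incr/ltW //].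
exact: lexx.
Qed.

Lemma distr_cdf_step (t : R) : distr_cdf G t = \sum_(i < N | z i <= t) p i.
Proof.
rewrite G_step [RHS]big_mkcond; apply: eq_bigr => i _.
by case: ifP; rewrite ?mulr1 ?mulr0.
Qed.

Lemma distr_cdf_atom (i : 'I_N.-1) : distr_cdf G (z (widen_pred i)) = P i.
Proof. by rewrite distr_cdf_step; apply: eq_bigl => k; rewrite le_atoms. Qed.

Lemma partial_mass_in01 (i : 'I_N.-1) : 0 < P i < 1.
Proof.
apply/andP; split.
  rewrite /P /partial_mass (bigD1 (widen_pred i)) //=.
  by rewrite ltr_wpDr // sumr_ge0 // => k _; exact/ltW.
have iN : (i.+1 < N)%N by rewrite -ltn_predRL.
rewrite -p_sum1 (bigID (fun k : 'I_N => (k <= i)%N)) /= ltrDl.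
rewrite (bigD1 (Ordinal iN)) /= ?ltnn //.
by rewrite ltr_wpDr // sumr_ge0 // => k _; exact/ltW.
Qed.

Lemma quantile_step (i : 'I_N.-1) : quantile G (P i) = z (widen_pred i).
Proof.
apply: min_ofP => [|t /=]; first by rewrite /= distr_cdf_atom.
move=> Pt; rewrite leNgt; apply/negP => tz; move: Pt; apply/negP.
rewrite -ltNge distr_cdf_step.
(* Left of [z i] the CDF has not yet collected the mass [p i]. *)
rewrite /P /partial_mass [ltRHS](bigD1 (widen_pred i)) //=.
rewrite [ltRHS]addrC ltr_pwDr // [leLHS]big_mkcond [leRHS]big_mkcond.
apply: ler_sum => k _; case: ifPn => [kt|_]; last first.
  by case: ifP => // _; exact/ltW.
have : (k < widen_pred i)%N.
  by rewrite ltnNge -le_atoms -ltNge; exact: le_lt_trans kt tz.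
by move=> ki; rewrite (ltnW ki) -val_eqE /= (ltn_eqF ki).
Qed.

Lemma cdf_levels_step : cdf_levels G = range P.
Proof.
apply/seteqP; split => [a [a01 [t ta]]|_ [i _ <-]]; last first.
  by split; [exact: partial_mass_in01|exists (z (widen_pred i)); exact: distr_cdf_atom].
move: a01; rewrite -{a}ta distr_cdf_step => /andP[c0 c1].
have [k0 k0t|none] := pickP (fun k => z k <= t); last first.
  by move: c0; rewrite big_pred0 // ltxx.
(* The level is determined by the last atom at or below [t]. *)
case: (@arg_maxnP _ k0 (fun k => z k <= t) (fun k => k) k0t) => k kt kmax.
have below l : (z l <= t) = (l <= k)%N.
  apply/idP/idP => [/kmax //|]; rewrite -le_atoms => lk.
  exact: le_trans lk kt.
have kN : (k < N.-1)%N.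
  rewrite ltn_predRL ltn_neqAle ltn_ord andbT; apply/eqP => kN.
  move: c1; rewrite (eq_bigl xpredT) ?p_sum1 ?ltxx // => l.
  by rewrite below -ltnS kN ltn_ord.
exists (Ordinal kN) => //.
by rewrite /P /partial_mass; apply: eq_bigl => l; rewrite below.
Qed.

End step_cdf.

Theorem proposition3 (R : realType) (G : probability (measurableTypeR R) R)
  (N : nat) (p z : 'I_N -> R) (w : 'I_N.-1 -> {nonneg R})
  (p_gt0 : forall i : 'I_N, 0 < p i)
  (p_sum1 : \sum_(i < N) p i = 1)
  (z_incr : forall i j : 'I_N, (i < j)%N -> z i < z j)
  (G_step : forall t : R, distr_cdf G t = \sum_(i < N) p i * (z i <= t)%R%:R) :
  let P := partial_mass p in
  let mu : {measure set (measurableTypeR R) -> \bar R} := dirac_sum w P in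
  let S : R -> measurableTypeR R -> \bar R := fun x y => (S4 p z w x y)%:E in
  [/\ (* S4 and mu are well formed: levels in (0,1), S4 valued in [0,oo) *)
      [/\ forall i : 'I_N.-1, 0 < P i < 1,
          mu (~` `]0, 1[%classic) = 0%E
        & forall x y : R, 0 <= S4 p z w x y],
      forall x y : R, S x y = GDSd G mu x y,
      equitable S G
    & equitability_constant S G
        (\sum_(i < N.-1) (w i)%:num * P i * (1 - P i))].
Proof.
move=> P mu S.
have P01 i : 0 < P i < 1 by exact: partial_mass_in01.
have S_equitable : equitability_constant S G
    (\sum_(i < N.-1) (w i)%:num * P i * (1 - P i)).
  under eq_bigr do rewrite -mulrA.
  apply: equitability_constant_sum => i; apply: expected_elementary_score.
  exact: distr_cdf_atom.
split=> //; last by eexists; exact: S_equitable.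
- split=> // [|x y].
    rewrite /mu /= /dirac_sum big1 // => i _.
    rewrite diracE memNset ?mule0 //=.
    by apply; rewrite /= in_itv /= P01.
  apply: sumr_ge0 => i _; apply: mulr_ge0 => //; apply: elementary_score_ge0.
  by have /andP[/ltW -> /ltW ->] := P01 i.
- move=> x y.
  have finL : finite_set (cdf_levels G).
    rewrite (cdf_levels_step R G N p z) //; exact: finite_image finite_finset.
  rewrite /GDSd integral_dirac_sum.
  + rewrite /S /S4 -sumEFin; apply: eq_bigr => i _.
    rewrite (quantile_step R G N p z) // diracE mem_set ?mul1e //.
    by rewrite (cdf_levels_step R G N p z) //; exists i.
  + apply: countable_measurable; first exact: measurable_set1.
    exact: finite_set_countable.
  + exact: measurable_fun_finite.
  + move=> a [/andP[a0 a1] _]; rewrite lee_fin elementary_score_ge0 //.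
    by rewrite !ltW.
Qed.
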